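(* Let $T$ be a rising tree with encoding function $\Phi$. Then $\Phi$ is infinitely flat at any irrational $\alpha\in(0,1)$ whose continued fraction coefficients are bounded by some $K$. In fact, there exist $A,B>0$ depending only on $T$ and $K$ so that, for $x$ in a neighborhood of $0$, $$\left|\Phi(x+\alpha)-\Phi(\alpha)-\Phi'(\alpha)x\right|\le A\sqrt{|x|}\cdot e^{-B/\sqrt{|x|}}.$$
   Context: All fractions $k/n$ are in lowest terms with $n\ge1$. Two fractions $a/b<c/d$ in $[0,1]$ are Farey neighbours if $bc-ad=1$; their mediant is $(a+c)/(b+d)$. Each $q\in\mathbb Q\cap(0,1)$ is the mediant of a unique pair of Farey neighbours in $[0,1]$, denoted $q_0<q_0'$. A real Markov tree $T$ with base triple $(s_0,u_0,t_0)\in\mathbb R^3$ is a rooted planar trivalent tree (the root has degree 1, all other vertices degree 3) whose complementary regions carry real labels; the root edge has the region $s_0$ on its left, $t_0$ on its right, and leads to the region $u_0$; and for every non-root edge, with regions $s,t$ on its two sides and $r,u$ at its two ends, $r+u=st$. The regions are Farey-indexed by $\mathbb Q\cap[0,1]$, writing $m_q=m(T)_q$: $m_0=s_0$, $m_{1/2}=u_0$, $m_1=t_0$, and for each $q\in\mathbb Q\cap(0,1)$, if $p$ is the mediant of $q_0,q$ and $p'$ the mediant of $q,q_0'$, then $m_p=m_{q_0}m_q-m_{q_0'}$ and $m_{p'}=m_qm_{q_0'}-m_{q_0}$. The non-root vertices correspond to $q\in\mathbb Q\cap(0,1)$: the regions $q_0,q,q_0'$ meet at vertex $q$. Let $e_q$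 be the edge at vertex $q$ on the side of the root. It is (positively) directed away from the root if $2m_q-m_{q_0}m_{q_0'}>0$, towards the root if this is negative, and undirected if it is $0$. $T$ is a rising tree if all labels are $>2$ and all edges are positively directed away from the root except for those on a finite (possibly empty) simple path starting at the root. The encoding function $\Phi=\Phi_T:[0,1]\to\mathbb R_{\ge0}$ is the unique continuous function with $m_{k/n}=2\cosh(n\Phi(k/n))$ for all $k/n\in\mathbb Q\cap[0,1]$; it exists for rising trees and is differentiable at every irrational in $(0,1)$. Continued fractions are the standard ones $\alpha=[a_0,a_1,a_2,\dots]$ with integer $a_i$, $a_i\ge1$ for $i\ge1$; the coefficients are bounded by $K$ if $a_i\le K$ for all $i$. A function $f$ defined on an open interval containing $a$, with $f'(a)$ existing, is infinitely flat at $a$ if for every integer $n\ge2$ there is $\delta_n>0$ so that $f(x+a)-f(a)-f'(a)x=O(|x|^n)$ for all $x\in(-\delta_n,\delta_n)$. The right side of the displayed bound is read as $0$ at $x=0$. *)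

(* Defs.v *)
From HB Require Import structures.
From mathcomp Require Export all_boot all_order all_algebra.
From mathcomp Require Export all_classical all_reals all_analysis.
Export Order.TTheory GRing.Theory Num.Theory.
Export numFieldNormedType.Exports.

Set Implicit Arguments.
Unset Strict Implicit.
Unset Printing Implicit Defensive.

Local Open Scope ring_scope.
Local Open Scope classical_set_scope.

(** * Farey neighbours and mediants *)

Definition farey_neighbours (x y : rat) : Prop :=
  [/\ 0 <= x, x < y, y <= 1 & numq y * denq x - numq x * denq y = 1].

Definition mediant (x y : rat) : rat :=
  (numq x + numq y)%:~R / (denq x + denq y)%:~R.

(* [farey_parents q x y] says that (x, y) is the pair written (q_0, q_0'). *)
Definition farey_parents (q x y : rat) : Prop :=
  farey_neighbours x y /\ q = mediant x y.

(** * Real Markov trees *)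

(* Regions are indexed by the rationals of [0, 1]; the values of [label]
   elsewhere are irrelevant.  The base triple (s_0, u_0, t_0) is
   (label 0, label (1/2), label 1). *)
Record markov_tree (R : realType) := MarkovTree {
  label :> rat -> R ;
  label_left : forall q x y, farey_parents q x y ->
    label (mediant x q) = label x * label q - label y ;
  label_right : forall q x y, farey_parents q x y ->
    label (mediant q y) = label q * label y - label x
}.

(* A vertex of the tree is the root, encoded by [None], or [Some q] with q a
   rational of (0, 1).  The edge e_q joins [Some q] to its parent, so e_q is
   indexed by q as well; e_{1/2} is the root edge. *)
Definition tree_child (v : option rat) (q : rat) : Prop :=
  if v is Some p then
    exists x y, farey_parents p x y /\ (q = mediant x p \/ q = mediant p y)
  else q = mediant 0 1.

(* A simple path from the root of a tree never goes back towards the root: it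
   is given by the list [q_1; ...; q_k] of its successive non-root vertices,
   each a child of the preceding one, and its edges are e_{q_1}, ..., e_{q_k}. *)
Fixpoint descending_path (v : option rat) (s : seq rat) : Prop :=
  if s is q :: s' then tree_child v q /\ descending_path (Some q) s' else True.

Definition edge_away (R : realType) (T : markov_tree R) (q : rat) : Prop :=
  forall x y, farey_parents q x y -> 0 < 2 * T q - T x * T y.

Definition rising (R : realType) (T : markov_tree R) : Prop :=
  (forall q : rat, 0 <= q <= 1 -> 2 < T q) /\
  exists s : seq rat, descending_path None s /\
    forall q : rat, 0 < q < 1 -> q \notin s -> edge_away T q.

(** * The encoding function *)

Definition cosh (R : realType) (x : R) : R := (expR x + expR (- x)) / 2.

(* Functions on [0, 1] are represented by total functions on R whose values
   outside [0, 1] are irrelevant. *)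
Definition encoding_function (R : realType) (T : markov_tree R)
    (Phi : R -> R) : Prop :=
  [/\ {within `[0, 1], continuous Phi},
      forall x : R, 0 <= x <= 1 -> 0 <= Phi x &
      forall q : rat, 0 <= q <= 1 ->
        T q = 2 * cosh ((denq q)%:~R * Phi (ratr q))].

(** * Continued fractions *)

(* The complete quotients alpha_0 = alpha,
   alpha_{i+1} = 1 / (alpha_i - floor alpha_i); a_i is the floor of alpha_i.
   They are only meaningful for all i when alpha is irrational. *)
Fixpoint complete_quotient (R : realType) (alpha : R) (i : nat) : R :=
  if i is j.+1 then
    let b := complete_quotient alpha j in (b - (Num.floor b)%:~R)^-1
  else alpha.

Definition cf_coef (R : realType) (alpha : R) (i : nat) : int :=
  Num.floor (complete_quotient alpha i).

Definition cf_bounded (R : realType) (alpha : R) (K : nat) : Prop :=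
  forall i : nat, cf_coef alpha i <= K%:Z.

(** * Infinite flatness *)

Definition infinitely_flat (R : realType) (f : R -> R) (a : R) : Prop :=
  derivable f a 1 /\
  forall n : nat, (2 <= n)%N ->
    exists delta C : R, 0 < delta /\
      forall x : R, - delta < x < delta ->
        `|f (x + a) - f a - derive1 f a * x| <= C * `|x| ^+ n.

(* Main.v *)
(* Write x, y, z for the labels at a vertex q, in the order q_0, q_0', q, and
   x = 2 cosh f, y = 2 cosh g, z = 2 cosh e. Since x^2 + y^2 + z^2 - x y z is the
   same at all vertices, so is (z - 2 cosh (f + g)) (z - 2 cosh (f - g)); when
   e_q is directed away from the root the second factor is bounded below. As
   labels grow exponentially in the denominator, F(k, n) = n Phi(k/n) is
   additive on Farey pairs up to an error exponentially small in the
   denominator of the mediant. Hence on the interval of a Farey pair (a/b, c/d)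
   the function Phi is within O(exp(-h (b + d))) of its chord, and the chord
   slopes of the Farey intervals around alpha converge at the same rate. If the
   continued fraction coefficients are bounded, a point x + alpha that leaves
   these intervals at denominator sum N satisfies |x| >= k / N^2. *)

Require Import Defs.
From mathcomp Require Import zify ring lra.

Set Implicit Arguments.
Unset Strict Implicit.
Unset Printing Implicit Defensive.

Local Open Scope ring_scope.
Local Open Scope classical_set_scope.

(** * Farey pairs of natural numbers and induction along the Farey tree *)

Definition farey_pair (a b c d : nat) : bool :=
  [&& 0 < b, c <= d & b * c == (a * d).+1]%N.

(** Of two neighbours with different denominators, the one with the larger denominator is a mediant,
    and subtracting the other recovers the parent pair. Equal denominators occur only for 0/1 and
    1/1. *)
Lemma farey_pair_ind (P : nat -> nat -> nat -> nat -> Prop) :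
  P 0 1 1 1 ->
  (forall a b c d, farey_pair a b c d -> P a b c d ->
     P a b (a + c) (b + d) /\ P (a + c) (b + d) c d)%N ->
  forall a b c d, farey_pair a b c d -> P a b c d.
Proof.
move=> P0 PS a b c d; have [n] := ubnP (b + d)%N.
elim: n a b c d => // n IH a b c d ltn /and3P[b0 cd /eqP e].
have c0 : (0 < c)%N by case: (c) e => //; rewrite muln0.
have ab : (a < b)%N.
  have h : (b * c <= b * d)%N by rewrite leq_mul2l cd orbT.
  by rewrite -(ltn_pmul2r (leq_trans c0 cd)); rewrite -e in h *.
have [bd|db|bd] := ltngtP b d.
- have ac : (a < c)%N.
    have h : (a * b <= a * d)%N by rewrite leq_mul2l (ltnW bd) orbT.
    by rewrite -(ltn_pmul2l b0) e ltnS mulnC.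
  have fp : farey_pair a b (c - a) (d - b).
    apply/and3P; split => //; last by apply/eqP; nia.
    rewrite leq_subLR; nia.
  have /PS[//|] := fp; first by apply: IH => //; lia.
  by rewrite !subnKC// ltnW.
- have ca : (c <= a)%N by nia.
  have fp : farey_pair (a - c) (b - d) c d.
    by apply/and3P; split => //; [lia|apply/eqP; nia].
  have /PS[//|_] := fp; first by apply: IH => //; lia.
  by rewrite !subnK// ltnW.
- have b1 : b = 1%N by rewrite -bd in e; have : (a < c)%N; nia.
  have [-> -> -> -> //] : [/\ a = 0, b = 1, c = 1 & d = 1]%N by split; lia.
Qed.

Lemma farey_pairS (a b c d : nat) : farey_pair a b c d ->
  farey_pair a b (a + c) (b + d) /\ farey_pair (a + c) (b + d) c d.
Proof.
move=> h; have [ab] : (a < b)%N /\ (0 < d)%N.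
  by move: h => /and3P[? ? /eqP]; nia.
case/and3P: h => b0 cd /eqP e.
by split; apply/and3P; split; try apply/eqP; try lia; nia.
Qed.

Lemma farey_pairP (a b c d : nat) : farey_pair a b c d ->
  [/\ (a < b)%N, (0 < b)%N, (0 < d)%N, (c <= d)%N & (0 < c)%N].
Proof. by case/and3P => b0 cd /eqP e; split => //; nia. Qed.

Lemma farey_pair_coprime (a b c d : nat) : farey_pair a b c d ->
  coprime a b /\ coprime c d.
Proof.
move=> /and3P[b0 cd /eqP e].
have h x : (x %| b * c)%N -> (x %| a * d)%N -> (x == 1)%N.
  by rewrite e -addn1 => h1 h2; rewrite dvdn_addr// dvdn1 in h1.
split; apply: h; first by rewrite dvdn_mulr// dvdn_gcdr.
- by rewrite dvdn_mulr// dvdn_gcdl.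
- by rewrite dvdn_mull// dvdn_gcdl.
- by rewrite dvdn_mull// dvdn_gcdr.
Qed.

Lemma numq_frac (k n : nat) : coprime k n -> (0 < n)%N ->
  numq (k%:R / n%:R) = k.
Proof.
move=> kn n0; rewrite -[k%:R]/(k%:Z%:~R) -[n%:R]/(n%:Z%:~R) coprimeq_num//.
by rewrite gtr0_sg// mul1r.
Qed.

Lemma denq_frac (k n : nat) : coprime k n -> (0 < n)%N ->
  denq (k%:R / n%:R) = n.
Proof.
move=> kn n0; rewrite -[k%:R]/(k%:Z%:~R) -[n%:R]/(n%:Z%:~R) coprimeq_den//.
by case: n n0 {kn}.
Qed.

Lemma farey_pair_parents (a b c d : nat) : farey_pair a b c d ->
  farey_parents ((a + c)%:R / (b + d)%:R) (a%:R / b%:R) (c%:R / d%:R).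
Proof.
move=> h; have [ca cc] := farey_pair_coprime h.
have [ab b0 d0 cd c0] := farey_pairP h; case/and3P: h => _ _ /eqP e.
split; last first.
  by rewrite /mediant !numq_frac ?denq_frac// -!PoszD.
split.
- by rewrite divr_ge0 ?ler0n.
- rewrite ltr_pdivrMr ?ltr0n// mulrAC ltr_pdivlMr ?ltr0n// -!natrM ltr_nat.
  by rewrite [(c * b)%N]mulnC e.
- by rewrite ler_pdivrMr ?ltr0n// mul1r ler_nat.
- by rewrite !numq_frac ?denq_frac//; lia.
Qed.

(** * The Markov invariant and hyperbolic cosines *)

(** The Fricke polynomial: for traces x, y, z of A, B, AB in SL(2), it equals tr [A, B] + 2. *)
Definition markov_const (R : realType) (x y z : R) : R :=
  x ^+ 2 + y ^+ 2 + z ^+ 2 - x * y * z.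

(** Vieta: passing to a child replaces one label by the other root of the same quadratic. *)
Lemma markov_const_tree (R : realType) (T : markov_tree R) :
  exists k : R, forall a b c d : nat, farey_pair a b c d ->
    markov_const (T (a%:R / b%:R)) (T (c%:R / d%:R))
      (T ((a + c)%:R / (b + d)%:R)) = k.
Proof.
exists (markov_const (T (0%:R / 1%:R)) (T (1%:R / 1%:R)) (T (1%:R / 2%:R))).
apply: farey_pair_ind => // a b c d abcd IH.
have [lp rp] := farey_pairS abcd; have pp := farey_pair_parents abcd.
have [_ el] := farey_pair_parents lp; have [_ er] := farey_pair_parents rp.
by rewrite -IH el er (label_left T pp) (label_right T pp) /markov_const;
  split; ring.
Qed.

(** As a quadratic in z, the right side has roots 2 cosh (f + g) and 2 cosh (f - g). *)
Lemma markov_const_cosh (R : realType) (f g z : R) :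
  (z - 2 * cosh (f + g)) * (z - 2 * cosh (f - g)) =
  markov_const (2 * cosh f) (2 * cosh g) z - 4.
Proof.
rewrite /markov_const /cosh !opprD opprK !expRD !expRN.
have := expR_gt0 f; have := expR_gt0 g.
move: (expR f) (expR g) => u v v0 u0.
by field; rewrite !gt_eqF.
Qed.

Lemma cosh_subE (R : realType) (x y : R) :
  2 * cosh x - 2 * cosh y = (expR x - expR y) * (1 - expR (- x) * expR (- y)).
Proof.
rewrite /cosh !expRN; have := expR_gt0 x; have := expR_gt0 y.
move: (expR x) (expR y) => u v v0 u0.
by field; rewrite !gt_eqF.
Qed.

Lemma cosh_add_sub (R : realType) (f g : R) :
  2 * cosh (f + g) - 2 * cosh (f - g) =
  (expR f - expR (- f)) * (expR g - expR (- g)).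
Proof.
rewrite /cosh !opprD opprK !expRD !expRN.
have := expR_gt0 f; have := expR_gt0 g.
move: (expR f) (expR g) => u v v0 u0.
by field; rewrite !gt_eqF.
Qed.

Lemma cosh_le_expR (R : realType) (x : R) : 0 <= x -> cosh x <= expR x.
Proof.
move=> x0; have : expR (- x) <= expR x by rewrite ler_expR; lra.
rewrite /cosh; lra.
Qed.

(** The constant is 2 sinh r, the least derivative of 2 cosh on [r, oo). Its factor [expR r] is what
    later makes the additivity error exponentially small. *)
Lemma cosh_expansive (R : realType) (r x y : R) : 0 <= r -> r <= x -> r <= y ->
  `|x - y| * (expR r * (1 - expR (- r) * expR (- r))) <=
  `|2 * cosh x - 2 * cosh y|.
Proof.
move=> r0; wlog yx : x y / y <= x => [hw rx ry|rx ry].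
  have [yx|xy] := leP y x; first exact: hw.
  by rewrite distrC [leRHS]distrC; apply: hw => //; exact: ltW.
have er : 0 <= 1 - expR (- r) * expR (- r).
  by rewrite subr_ge0 -expRD expR_le1; lra.
rewrite ger0_norm ?subr_ge0//; apply: le_trans (ler_norm _).
rewrite cosh_subE mulrA; apply: ler_pM => //.
- by rewrite mulr_ge0 ?subr_ge0// expR_ge0.
- have -> : expR x - expR y = (expR (x - y) - 1) * expR y.
    by rewrite mulrBl -expRD subrK mul1r.
  apply: ler_pM; rewrite ?subr_ge0 ?expR_ge0 ?ler_expR//.
  by rewrite lerBrDl expR_ge1Dx.
- by rewrite lerB// ler_pM ?expR_ge0// ler_expR lerN2.
Qed.

(** * Exponential growth of the labels *)

Lemma finite_exp_growth (R : realType) (f : rat -> R) (s : seq rat) :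
  (forall q, q \in s -> 2 < f q) ->
  exists2 h : R, 0 < h & forall q, q \in s -> 2 * expR (h * (denq q)%:~R) <= f q.
Proof.
elim: s => [_|q s IH fs]; first by exists 1.
have [|h h0 hs] := IH; first by move=> r rs; apply: fs; rewrite inE rs orbT.
have q2 : 2 < f q by apply: fs; rewrite mem_head.
have ln0 : 0 < ln (f q / 2) by rewrite ln_gt0// ltr_pdivlMr// mul1r.
have den0 (r : rat) : 0 < (denq r)%:~R :> R by rewrite ltr0z denq_gt0.
exists (Num.min h (ln (f q / 2) / (denq q)%:~R)).
  by rewrite lt_min h0 divr_gt0.
move=> r; rewrite inE => /orP[/eqP ->|rs].
  have : expR (Num.min h (ln (f q / 2) / (denq q)%:~R) * (denq q)%:~R) <= f q / 2.
    rewrite -[leRHS]lnK ?ler_expR; last by rewrite posrE divr_gt0//; lra.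
    by rewrite -ler_pdivlMr// ge_min lexx orbT.
  lra.
apply: le_trans (hs _ rs); rewrite ler_pM2l// ler_expR ler_pM2r//.
by rewrite ge_min lexx.
Qed.

Lemma seq_denq_bounded (s : seq rat) :
  exists D : nat, forall q, q \in s -> denq q <= D%:Z.
Proof.
elim: s => [|q s [D hD]]; first by exists 0%N.
exists (maxn `|denq q| D) => r; rewrite inE => /orP[/eqP ->|/hD]; lia.
Qed.

(* The half-labels are supermultiplicative at the edges directed away from the
   root, hence grow exponentially in the denominator. *)
Lemma rising_exp_growth (R : realType) (T : markov_tree R) : rising T ->
  exists2 h : R, 0 < h & forall a b c d : nat, farey_pair a b c d ->
    2 * expR (h * b%:R) <= T (a%:R / b%:R) /\
    2 * expR (h * d%:R) <= T (c%:R / d%:R).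
Proof.
move=> [T2 [s [_ away]]].
(* The rate h must serve the start of the induction, 0 and 1, and the vertices of the exceptional
   path, where the edge gives no information. The filter keeps the fractions whose labels are known
   to exceed 2. *)
have [|h h0 hs] := @finite_exp_growth R T [seq q <- 0 :: 1 :: s | 0 <= q <= 1].
  by move=> q; rewrite mem_filter => /andP[/T2].
exists h => //; apply: farey_pair_ind.
  have hq (q : rat) : q \in [:: 0; 1] -> 2 * expR (h * (denq q)%:~R) <= T q.
    rewrite !inE => q01; apply: hs; rewrite mem_filter !inE orbA q01 andbT.
    by case/orP: q01 => /eqP ->.
  rewrite !divr1; split; [exact: (hq 0)|exact: (hq 1)].
move=> a b c d abcd [IH1 IH2].
suff H : 2 * expR (h * (b + d)%:R) <= T ((a + c)%:R / (b + d)%:R) by [].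
have [ab b0 d0 cd c0] := farey_pairP abcd.
have [lp _] := farey_pairS abcd; have [_ cop] := farey_pair_coprime lp.
have [qs|qs] := boolP ((a + c)%:R / (b + d)%:R \in s).
  have := hs ((a + c)%:R / (b + d)%:R).
  rewrite denq_frac ?addn_gt0 ?b0//; apply.
  rewrite mem_filter !inE qs !orbT andbT divr_ge0 ?ler0n//=.
  rewrite ler_pdivrMr ?ltr0n ?addn_gt0 ?b0// mul1r ler_nat; lia.
have q01 : 0 < ((a + c)%:R / (b + d)%:R : rat) < 1.
  rewrite divr_gt0 ?ltr0n ?addn_gt0 ?c0 ?b0 ?orbT//=.
  by rewrite ltr_pdivrMr ?ltr0n ?addn_gt0 ?b0// mul1r ltr_nat; lia.
have aw := away _ q01 qs _ _ (farey_pair_parents abcd).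
have : 2 * expR (h * b%:R) * (2 * expR (h * d%:R)) <=
       T (a%:R / b%:R) * T (c%:R / d%:R).
  by apply: ler_pM => //; rewrite mulr_ge0// expR_ge0.
rewrite natrD mulrDr expRD; lra.
Qed.

(** * Almost additivity of the homogenized encoding function *)

(** With zero error, F would be a linear form in (k, n) on the coprime pairs reached by Farey
    descent. *)
Definition almost_additive (R : realType) (F : nat -> nat -> R) (C h : R) :=
  forall a b c d : nat, farey_pair a b c d ->
    `|F (a + c)%N (b + d)%N - (F a b + F c d)| <= C * expR (- (h * (b + d)%:R)).

Definition homogenize (R : realType) (Phi : R -> R) (k n : nat) : R :=
  n%:R * Phi (k%:R / n%:R).

Lemma frac01 (R : realType) (k n : nat) : (k <= n)%N -> (0 < n)%N ->
  0 <= (k%:R / n%:R : R) <= 1.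
Proof.
move=> kn n0; rewrite divr_ge0 ?ler0n//=.
by rewrite ler_pdivrMr ?ltr0n// mul1r ler_nat.
Qed.

Lemma encoding_homogenize (R : realType) (T : markov_tree R) (Phi : R -> R)
    (k n : nat) : encoding_function T Phi -> coprime k n -> (k <= n)%N ->
  (0 < n)%N -> T (k%:R / n%:R) = 2 * cosh (homogenize Phi k n).
Proof.
move=> [_ _ e] kn le0 n0; rewrite e.
  have -> : ratr (k%:R / n%:R) = k%:R / n%:R :> R.
    by rewrite fmorph_div /= !ratr_nat.
  by rewrite denq_frac.
rewrite divr_ge0 ?ler0n//=.
by rewrite ler_pdivrMr ?ltr0n// mul1r ler_nat.
Qed.

Lemma le_of_cosh (R : realType) (x y : R) :
  0 <= y -> expR x <= cosh y -> x <= y.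
Proof.
by move=> /cosh_le_expR cy xy; rewrite -ler_expR; exact: le_trans xy cy.
Qed.

(** The product of the distances from 2 cosh z to the two roots is |k - 4|. The direction of the
    edge bounds the distance to the smaller root below, hence the other distance above;
    expansiveness of cosh then yields the factor [expR (- r)]. *)
Lemma away_edge_almost_additive (R : realType) (h r f g z : R) :
  0 < h -> h <= f -> h <= g -> h <= r -> r <= z -> r <= f + g ->
  0 < 2 * (2 * cosh z) - 2 * cosh f * (2 * cosh g) ->
  `|z - (f + g)| <=
  2 * `|markov_const (2 * cosh f) (2 * cosh g) (2 * cosh z) - 4| /
    (expR h - expR (- h)) ^+ 2 / (1 - expR (- h) * expR (- h)) * expR (- r).
Proof.
move=> h0 hf hg hr rz rfg aw; set k := markov_const _ _ _.
set t := expR h - expR (- h).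
have t0 : 0 < t by rewrite subr_gt0 ltr_expR gtrN.
have e0 : 0 < 1 - expR (- h) * expR (- h).
  by rewrite subr_gt0 -expRD expR_lt1 -opprD oppr_lt0 addr_gt0.
have ht x : h <= x -> t <= expR x - expR (- x).
  by move=> hx; rewrite lerB// ler_expR// lerN2.
(* The edge condition puts 2 cosh z above the midpoint of the roots, so its distance to the smaller
   one is at least half their gap. *)
have lb : t ^+ 2 <= 2 * (2 * cosh z - 2 * cosh (f - g)).
  have H : t * t <= (expR f - expR (- f)) * (expR g - expR (- g)).
    by apply: ler_pM; rewrite ?ht// ltW.
  have H' : 2 * cosh f * (2 * cosh g) = 2 * cosh (f + g) + 2 * cosh (f - g).
    (* The difference of the identities at z = 1 and z = 0 gives the sum of the roots. *)
    have := markov_const_cosh f g 1; have := markov_const_cosh f g 0.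
    by rewrite /markov_const; clear; lra.
  move: H aw; rewrite -cosh_add_sub expr2 H'; clear; lra.
have ub : `|2 * cosh z - 2 * cosh (f + g)| <= 2 * `|k - 4| / t ^+ 2.
  rewrite ler_pdivlMr ?exprn_gt0// -markov_const_cosh normrM.
  rewrite [`|_ - 2 * cosh (f - g)|]ger0_norm; last first.
    by rewrite -(pmulr_rge0 _ (ltr0Sn _ 1)) (le_trans _ lb)// exprn_ge0// ltW.
  by rewrite [leRHS]mulrCA ler_wpM2l.
have H := cosh_expansive (ltW (lt_le_trans h0 hr)) rz rfg.
rewrite [X in _ * X]expRN ler_pdivlMr ?expR_gt0// ler_pdivlMr//.
apply: le_trans ub; apply: le_trans H.
rewrite -mulrA ler_wpM2l// ler_wpM2l ?expR_ge0//.
by rewrite lerB// ler_pM ?expR_ge0// ler_expR lerN2.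
Qed.

Lemma rising_almost_additive (R : realType) (T : markov_tree R) (Phi : R -> R) :
  rising T -> encoding_function T Phi ->
  exists C h : R, [/\ 0 <= C, 0 < h & almost_additive (homogenize Phi) C h].
Proof.
move=> rT eT; have [h h0 hh] := rising_exp_growth rT.
have [k hk] := markov_const_tree T.
have [_ [s [_ away]]] := rT; have [D hD] := seq_denq_bounded s.
have [cPhi Phi0 _] := eT.
have [M hM] : exists M, forall x, 0 <= x <= 1 -> Phi x <= M.
  have [c _ hc] := EVT_max ler01 cPhi.
  by exists (Phi c) => x x01; apply: hc; rewrite in_itv.
have M0 : 0 <= M by apply: le_trans (hM 0 _); rewrite ?Phi0 ?lexx ?ler01.
(* [C1] serves the edges directed away. [C2] serves the finitely many others, of denominator at most
   D, where boundedness of Phi suffices. *)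
pose C1 := 2 * `|k - 4| / (expR h - expR (- h)) ^+ 2 /
  (1 - expR (- h) * expR (- h)).
pose C2 := D%:R * M * expR (h * D%:R).
have C10 : 0 <= C1.
  apply: divr_ge0; first by rewrite divr_ge0 ?sqr_ge0 ?mulr_ge0.
  by rewrite subr_ge0 -expRD expR_le1 -opprD oppr_le0 addr_ge0// ltW.
have C20 : 0 <= C2 by rewrite !mulr_ge0 ?expR_ge0.
exists (C1 + C2), h; split => //; first exact: addr_ge0.
move=> a b c d abcd.
have [ab b0 d0 cd c0] := farey_pairP abcd.
have [cop1 cop2] := farey_pair_coprime abcd.
have [lp _] := farey_pairS abcd; have [_ cop] := farey_pair_coprime lp.
have [hb hd] := hh _ _ _ _ abcd; have [_ hz] := hh _ _ _ _ lp.
have bd0 : (0 < b + d)%N by rewrite addn_gt0 b0.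
have acbd : (a + c <= b + d)%N by lia.
have := hk _ _ _ _ abcd; move: hb hd hz.
have aw : (a + c)%:R / (b + d)%:R \notin s ->
    0 < 2 * T ((a + c)%:R / (b + d)%:R) - T (a%:R / b%:R) * T (c%:R / d%:R).
  move=> qs; apply: away qs _ _ (farey_pair_parents abcd).
  rewrite divr_gt0 ?ltr0n ?addn_gt0 ?c0 ?b0 ?orbT//=.
  by rewrite ltr_pdivrMr ?ltr0n// mul1r ltr_nat; lia.
move: aw; rewrite !(encoding_homogenize eT)// 1?ltnW//.
have Fge0 x y : (x <= y)%N -> (0 < y)%N -> 0 <= homogenize Phi x y.
  by move=> xy y0; rewrite mulr_ge0// Phi0// frac01.
have FleM x y : (x <= y)%N -> (0 < y)%N -> homogenize Phi x y <= y%:R * M.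
  by move=> xy y0; rewrite ler_pM2l ?ltr0n// hM// frac01.
move: (Fge0 _ _ (ltnW ab) b0) (Fge0 _ _ cd d0) (Fge0 _ _ acbd bd0).
move: (FleM _ _ (ltnW ab) b0) (FleM _ _ cd d0) (FleM _ _ acbd bd0).
move: (homogenize Phi a b) (homogenize Phi c d)
  (homogenize Phi (a + c) (b + d)).
move=> f g z fM gM zM f0 g0 z0 aw; rewrite !ler_pM2l// => hf hg hz kE.
have {}hf := le_of_cosh f0 hf; have {}hg := le_of_cosh g0 hg.
have {}hz := le_of_cosh z0 hz.
rewrite mulrDl; have [qs|/aw {}aw] := boolP ((a + c)%:R / (b + d)%:R \in s).
  apply: ler_wpDl; first by rewrite mulr_ge0 ?expR_ge0.
  have nD : ((b + d)%:R : R) <= D%:R.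
    by rewrite ler_nat -lez_nat; have := hD _ qs; rewrite denq_frac.
  (* Both z and f + g lie between 0 and (b + d) M. *)
  apply: (@le_trans _ _ (D%:R * M)).
    apply: (@le_trans _ _ ((b + d)%:R * M)); last by rewrite ler_wpM2r.
    move: zM; rewrite natrD mulrDl ler_norml.
    by clear -f0 g0 z0 fM gM => zM; apply/andP; split; lra.
  rewrite /C2 -[X in _ <= X]mulrA -expRD ler_peMr ?mulr_ge0//.
  by rewrite -[leLHS]expR0 ler_expR -mulrBr mulr_ge0 ?subr_ge0// ltW.
apply: ler_wpDr; first by rewrite mulr_ge0 ?expR_ge0.
have hr (x : R) n : (0 < n)%N -> h * n%:R <= x -> h <= x.
  by move=> n0; apply: le_trans; rewrite ler_peMr ?ler1n// ltW.
rewrite /C1 -kE; apply: away_edge_almost_additive => //.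
- exact: hr hf.
- exact: hr hg.
- exact: (hr _ (b + d)%N).
- by rewrite natrD mulrDr lerD.
Qed.

(** * Farey intervals and approximation by chords *)

(** The width is exactly 1/(bd), and b + d <= 2bd for positive integers. *)
Lemma farey_pair_width (R : realType) (a b c d : nat) : farey_pair a b c d ->
  0 < (c%:R / d%:R - a%:R / b%:R : R) <= 2 / (b + d)%:R.
Proof.
move=> abcd; have [ab b0 d0 cd c0] := farey_pairP abcd.
case/and3P: abcd => _ _ /eqP e.
have e' : b%:R * c%:R = a%:R * d%:R + 1 :> R by rewrite -!natrM e -addn1 natrD.
have b1 : 1 <= b%:R :> R by rewrite ler1n.
have d1 : 1 <= d%:R :> R by rewrite ler1n.
have -> : c%:R / d%:R - a%:R / b%:R = (b%:R * d%:R)^-1 :> R.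
  transitivity ((b%:R * c%:R - a%:R * d%:R) / (b%:R * d%:R) : R).
    by field; rewrite !pnatr_eq0 -!lt0n b0 d0.
  by rewrite e' [X in X - _]addrC addrK div1r.
rewrite natrD; move: b1 d1; move: (b%:R) (d%:R) => u v u1 v1.
have u0 : 0 < u by apply: lt_le_trans u1.
have v0 : 0 < v by apply: lt_le_trans v1.
rewrite invr_gt0 mulr_gt0//= ler_pdivlMr ?addr_gt0//.
rewrite mulrC ler_pdivrMr ?mulr_gt0//.
have : 0 <= (u - 1) * (v - 1) by rewrite mulr_ge0 ?subr_ge0.
nra.
Qed.

(** Cutting at the mediant and keeping the half that contains y raises the denominator sum by at
    least 1 each time. *)
Lemma farey_descent (R : realType) (y : R)
    (P : nat -> nat -> nat -> nat -> Prop) :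
  (forall a b c d, farey_pair a b c d -> P a b c d ->
     P a b (a + c) (b + d) /\ P (a + c) (b + d) c d)%N ->
  forall n a b c d : nat, farey_pair a b c d -> P a b c d ->
    a%:R / b%:R <= y <= c%:R / d%:R ->
  exists a' b' c' d' : nat, [/\ farey_pair a' b' c' d', P a' b' c' d',
    a'%:R / b'%:R <= y <= c'%:R / d'%:R & (n <= b' + d')%N].
Proof.
move=> PS; elim=> [|n IH] a b c d abcd Pabcd yI; first by exists a, b, c, d.
have [a' [b' [c' [d' [fp Pp /andP[y1 y2] nbd]]]]] := IH _ _ _ _ abcd Pabcd yI.
have [lp rp] := farey_pairS fp; have [Pl Pr] := PS _ _ _ _ fp Pp.
have [ab b0 d0 cd c0] := farey_pairP fp.
have [h|h] := leP y ((a' + c')%:R / (b' + d')%:R).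
  by exists a', b', (a' + c')%N, (b' + d')%N; split => //; [rewrite y1|lia].
by exists (a' + c')%N, (b' + d')%N, c', d'; split => //; [rewrite ltW|lia].
Qed.

Lemma itv01_continuous_dist (R : realType) (f : R -> R) (y e : R) :
  {within `[0, 1], continuous f} -> 0 <= y <= 1 -> 0 < e ->
  exists2 dl : R, 0 < dl &
    forall x, 0 <= x <= 1 -> `|y - x| < dl -> `|f y - f x| < e.
Proof.
move=> /subspace_continuousP cf y01 e0.
have /cf/cvgrPdist_lt/(_ e e0) : `[0, 1]%classic y by rewrite /= in_itv.
rewrite near_withinE => /nbhs_ballP[dl /= dl0 H].
by exists dl => // x x01 xy; apply: H => //=; rewrite in_itv.
Qed.

(* Descending from the pair (u, w) to v, the defect F v - L v of the linear
   function L that agrees with F at u and w picks up at most n_v - 1 errors. *)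
Lemma chord_approx (R : realType) (Phi : R -> R) (C h p r y : R)
    (a b c d : nat) :
  {within `[0, 1], continuous Phi} -> 0 <= C -> 0 < h ->
  almost_additive (homogenize Phi) C h -> farey_pair a b c d ->
  homogenize Phi a b = p * a%:R + r * b%:R ->
  homogenize Phi c d = p * c%:R + r * d%:R ->
  a%:R / b%:R <= y <= c%:R / d%:R ->
  `|Phi y - (p * y + r)| <= C * expR (- (h * (b + d)%:R)).
Proof.
move=> cPhi C0 h0 aa abcd ea ec yI.
set E := C * _; set F := homogenize Phi in aa ea ec.
have E0 : 0 <= E by rewrite mulr_ge0 ?expR_ge0.
have [ab b0 d0 cd c0] := farey_pairP abcd.
have y01 : 0 <= y <= 1.
  have /andP[_ h1] := frac01 R cd d0; have /andP[h2 _] := frac01 R (ltnW ab) b0.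
  by move/andP: yI => [y1 y2]; rewrite (le_trans h2)// (le_trans y2).
pose defect k n := `|F k n - (p * k%:R + r * n%:R)|.
(* The first conjunct makes every error met during the descent at most E. *)
pose P a' b' c' d' := [/\ (b + d <= b' + d')%N,
  defect a' b' <= E * (b'%:R - 1) & defect c' d' <= E * (d'%:R - 1)].
have P0 : P a b c d.
  by split=> //; rewrite /defect ?ea ?ec subrr normr0 mulr_ge0// subr_ge0 ler1n.
have PS a' b' c' d' : farey_pair a' b' c' d' -> P a' b' c' d' ->
    (P a' b' (a' + c') (b' + d') /\ P (a' + c') (b' + d') c' d')%N.
  move=> fp [nE hl hr].
  suff hm : defect (a' + c')%N (b' + d')%N <= E * ((b' + d')%:R - 1).
    by split; split => //; rewrite (leq_trans nE)// ?leq_addl ?leq_addr.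
  have ae : `|F (a' + c')%N (b' + d')%N - (F a' b' + F c' d')| <= E.
    apply: le_trans (aa _ _ _ _ fp) _; rewrite /E ler_wpM2l// ler_expR lerN2.
    by rewrite ler_pM2l// ler_nat.
  rewrite /defect.
  have -> : F (a' + c')%N (b' + d')%N - (p * (a' + c')%:R + r * (b' + d')%:R) =
     F (a' + c')%N (b' + d')%N - (F a' b' + F c' d') +
     ((F a' b' - (p * a'%:R + r * b'%:R)) +
      (F c' d' - (p * c'%:R + r * d'%:R))) by rewrite !natrD; ring.
  apply: le_trans (ler_normD _ _) _.
  apply: le_trans (lerD ae (le_trans (ler_normD _ _) (lerD hl hr))) _.
  by rewrite natrD le_eqVlt; apply/orP; left; apply/eqP; ring.
apply/ler_addgt0Pr => e e0.
have e20 : 0 < e / 2 by rewrite divr_gt0.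
have [dl dl0 hdl] := itv01_continuous_dist cPhi y01 e20.
(* By continuity it suffices to treat a nearby Farey end x: [w] controls both Phi y - Phi x and p (x
   - y), the + 1 covering p = 0. *)
pose w := Num.min dl (e / 2 / (`|p| + 1)).
have w0 : 0 < w by rewrite lt_min dl0 divr_gt0// ltr_wpDl.
have [n hn] : exists n : nat, 2 / w < n%:R.
  by exists (Num.truncn (2 / w)).+1; rewrite truncnS_gt.
have [a' [b' [c' [d' [fp [_ hl _] /andP[y1 y2] nbd]]]]] :=
  farey_descent PS n abcd P0 yI.
have [ab' b0' d0' cd' c0'] := farey_pairP fp.
have /andP[_ wd] := farey_pair_width R fp.
have yw : `|y - a'%:R / b'%:R| < w.
  rewrite ger0_norm ?subr_ge0//.
  apply: le_lt_trans (lerB y2 (lexx _)) _; apply: le_lt_trans wd _.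
  rewrite ltr_pdivrMr ?ltr0n ?addn_gt0 ?b0'// mulrC -ltr_pdivrMr//.
  by apply: lt_le_trans hn _; rewrite ler_nat.
have x01 := frac01 R (ltnW ab') b0'.
set x := a'%:R / b'%:R in y1 wd yw x01.
have [yw1 yw2] : `|y - x| < dl /\ `|y - x| < e / 2 / (`|p| + 1).
  by move: yw; rewrite lt_min => /andP.
(* Dividing the defect, at most E (b' - 1), by b' removes the dependence on the depth. *)
have Dx : `|Phi x - (p * x + r)| <= E.
  have b'0 : 0 < b'%:R :> R by rewrite ltr0n.
  rewrite -(ler_pM2l b'0) -{1}(gtr0_norm b'0) -normrM.
  have -> : b'%:R * (Phi x - (p * x + r)) = F a' b' - (p * a'%:R + r * b'%:R).
    by rewrite /F /homogenize -/x mulrBr /x; field; rewrite gt_eqF.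
  apply: le_trans hl _; rewrite mulrC ler_wpM2r//.
  by rewrite gerBl.
have Dp : `|p * (x - y)| <= e / 2.
  rewrite normrM distrC; apply: (@le_trans _ _ ((`|p| + 1) * `|y - x|)).
    by rewrite ler_wpM2r// lerDl.
  by move: (ltW yw2); rewrite ler_pdivlMr ?ltr_wpDl// mulrC.
have -> : Phi y - (p * y + r) =
  (Phi x - (p * x + r)) + ((Phi y - Phi x) + p * (x - y)) by ring.
apply: le_trans (ler_normD _ _) _; apply: lerD => //.
rewrite [leRHS]splitr; apply: le_trans (ler_normD _ _) _; apply: lerD => //.
by apply: ltW; apply: hdl.
Qed.

(** * Bounded continued fractions are badly approximable *)

Lemma irrational_gauss (R : realType) (x : R) :
  irrational x -> irrational (x - (Num.floor x)%:~R)^-1.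
Proof.
move=> ix [q _ e]; apply: ix; exists (q^-1 + (Num.floor x)%:~R) => //.
by rewrite rmorphD /= fmorphV /= e invrK ratr_int subrK.
Qed.

Lemma gauss_itv (R : realType) (x : R) :
  irrational x -> 0 < x - (Num.floor x)%:~R < 1.
Proof.
move=> ix; have /andP[h1 h2] := floor_itv x.
rewrite subr_gt0 lt_neqAle h1 andbT ltrBlDr addrC -[1]/(1%:~R) -intrD h2 andbT.
apply/eqP => e; apply: ix; exists (Num.floor x)%:~R => //.
by rewrite ratr_int.
Qed.

Lemma complete_quotientS (R : realType) (x : R) (i : nat) :
  complete_quotient (x - (Num.floor x)%:~R)^-1 i = complete_quotient x i.+1.
Proof. by elim: i => //= i ->. Qed.

Lemma cf_bounded_gauss (R : realType) (x : R) (K : nat) :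
  cf_bounded x K -> cf_bounded (x - (Num.floor x)%:~R)^-1 K.
Proof. by move=> h i; rewrite /cf_coef complete_quotientS; exact: h. Qed.

Lemma cf_bounded_gauss_lb (R : realType) (x : R) (K : nat) :
  irrational x -> cf_bounded x K -> K.+1%:R^-1 < x - (Num.floor x)%:~R.
Proof.
move=> ix hx; have /andP[t0 t1] := gauss_itv ix.
have := hx 1%N; rewrite /cf_coef /=.
move: (x - _) t0 t1 => t t0 t1 tK.
have /andP[_ h] := floor_itv t^-1.
rewrite invf_plt ?posrE//; apply: lt_le_trans h _.
by rewrite -[K.+1%:R]/(K.+1%:Z%:~R) ler_int intS addrC lerD2l.
Qed.

(** With t the fractional part of x, 1/t has integer part at least 1 and, by the lower bound applied
    one Gauss step later, fractional part above 1/(K + 1). Hence t <= (K + 1)/(K + 2). *)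
Lemma cf_bounded_gauss_ub (R : realType) (x : R) (K : nat) :
  irrational x -> cf_bounded x K -> K.+2%:R^-1 <= 1 - (x - (Num.floor x)%:~R).
Proof.
move=> ix hx; have := cf_bounded_gauss_lb (irrational_gauss ix) (cf_bounded_gauss hx).
have /andP[t0 t1] := gauss_itv ix.
move: (x - _) t0 t1 => t t0 t1.
have f1 : 1 <= (Num.floor t^-1)%:~R :> R.
  by rewrite -[1]/(1%:~R) ler_int floor_ge_int invf_ge1// ltW.
move=> H; have {}H : 1 + K.+1%:R^-1 <= t^-1.
  by apply: le_trans (lerD f1 (ltW H)) _; rewrite addrC subrK.
have k0 : 0 < K.+1%:R :> R by rewrite ltr0n.
have : t * (1 + K.+1%:R^-1) <= 1.
  by move: H; rewrite -(ler_pM2l t0) divff// gt_eqF.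
rewrite -[K.+2]addn1 natrD; move: k0; move: (K.+1%:R : R) => k k0 H'.
rewrite -subr_ge0.
have -> : 1 - t - (k + 1)^-1 = (1 - t * (1 + k^-1)) * (k / (k + 1)).
  by field; rewrite ?gt_eqF// addr_gt0.
by apply: mulr_ge0; rewrite ?subr_ge0// divr_ge0 ?addr_ge0// ltW.
Qed.

(* The product |y| q, with y = q x - p, is not monotone under the Gauss map;
   with the correction b it is exactly invariant. *)
Lemma cf_bounded_bad_approx (R : realType) (K q : nat) (p : int) (x b : R) :
  irrational x -> cf_bounded x K -> 0 <= b <= 1 -> (0 < q)%N ->
  K.+2%:R^-1 <= q%:R - b * (q%:R * x - p%:~R) ->
  K.+2%:R^-1 ^+ 2 <=
    `|q%:R * x - p%:~R| * (q%:R - b * (q%:R * x - p%:~R)).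
Proof.
have [n] := ubnP q; elim: n q p x b => // n IH q p x b qn ix hx /andP[b0 b1] q0.
have i1 := irrational_gauss ix; have h1 := cf_bounded_gauss hx.
have /andP[t0 t1] := gauss_itv ix.
have := ltW (cf_bounded_gauss_lb ix hx); have := cf_bounded_gauss_ub ix hx.
set t := x - _ in i1 h1 t0 t1 *.
have -> : x = t + (Num.floor x)%:~R by rewrite /t subrK.
clearbody t; pose p' := p - q%:Z * Num.floor x.
have -> : q%:R * (t + (Num.floor x)%:~R) - p%:~R = q%:R * t - p'%:~R.
  by rewrite /p' intrB intrM; ring.
set dl := K.+2%:R^-1 => tub tlb.
have {}tlb : dl <= t.
  by apply: le_trans tlb; rewrite lef_pV2 ?posrE ?ltr0n// ler_nat.
have dl0 : 0 < dl by rewrite invr_gt0 ltr0n.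
have q1 : 1 <= q%:R :> R by rewrite ler1n.
move=> hq.
(* Either both factors are at least [dl], or a Gauss step exchanges numerator and denominator and
   the smaller denominator p' allows induction. *)
suff [h|/andP[h1' h2']] : dl <= `|q%:R * t - p'%:~R| \/ 0 < p' < q%:Z.
- by rewrite expr2 ler_pM// ltW.
- have [m pm] : exists m : nat, p' = m by exists `|p'|%N; lia.
  have m0 : (0 < m)%N by lia.
  have mq : (m < q)%N by lia.
  have m1 : 1 <= m%:R :> R by rewrite ler1n.
  have bt : 0 <= b * t <= 1 by rewrite mulr_ge0 ?mulr_ile1// ltW.
  move: bt => /andP[bt0 bt1].
  (* With y = m/t - q the product is t |y| (q + bty). Since qt = m - ty, it equals |y| (m - t (1 -
     bt) y), which dictates the new correction. *)
  have := IH m q%:Z t^-1 (t * (1 - b * t)) _ i1 h1 _ m0.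
  have tn0 : t != 0 by rewrite gt_eqF.
  have e : q%:R * t - p'%:~R = - t * (m%:R * t^-1 - q%:R).
    by rewrite pm -[m%:~R]/(m%:R); field.
  have e2 : m%:R - t * (1 - b * t) * (m%:R * t^-1 - q%:R) =
      m%:R * (b * t) + (1 - b * t) * q%:R * t by field.
  rewrite e -[q%:~R]/(q%:R); set y := m%:R * t^-1 - q%:R in e2 *.
  have -> : `|- t * y| * (q%:R - b * (- t * y)) =
            `|y| * (m%:R - t * (1 - b * t) * y).
    rewrite normrM normrN (gtr0_norm t0) mulrAC mulrC; congr (_ * _).
    by rewrite /y; field.
  apply.
  + exact: leq_trans mq _.
  + rewrite mulr_ge0 ?subr_ge0 ?(ltW t0)//=.
    by rewrite mulr_ile1 ?(ltW t0) ?(ltW t1) ?subr_ge0 ?gerBl.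
  + rewrite e2; apply: le_trans tlb _.
    have e3 : t = t * (b * t) + (1 - b * t) * 1 * t by ring.
    rewrite [leLHS]e3 lerD//; first by rewrite ler_wpM2r// (le_trans (ltW t1)).
    by rewrite ler_wpM2r ?(ltW t0)// ler_wpM2l// subr_ge0.
(* For p' outside (0, q) the distance from qt to p' is at least t or 1 - t. *)
have [p0|p0] := leP p' 0.
  left; have pr : p'%:~R <= 0 :> R by rewrite lerz0.
  apply: le_trans (ler_norm _); apply: le_trans tlb _.
  have : t <= q%:R * t by rewrite ler_peMl// ltW.
  by move: pr; clear; lra.
have [pq|pq] := ltP p' q%:Z; first by right.
left; have pr : q%:R <= p'%:~R :> R by rewrite -[q%:R]/(q%:Z%:~R) ler_int.
rewrite distrC; apply: le_trans (ler_norm _); apply: le_trans tub _.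
have : 1 - t <= q%:R * (1 - t) by rewrite ler_peMl// subr_ge0 ltW.
by move: pr; clear; lra.
Qed.

(** The case b = 0 of the invariant product. *)
Lemma cf_bounded_dist (R : realType) (K k n : nat) (x : R) :
  irrational x -> cf_bounded x K -> (0 < n)%N ->
  K.+2%:R^-1 ^+ 2 / n%:R ^+ 2 <= `|x - k%:R / n%:R|.
Proof.
move=> ix hx n0; have n0' : 0 < n%:R :> R by rewrite ltr0n.
have := @cf_bounded_bad_approx R K n k x 0 ix hx _ n0.
rewrite lexx ler01 !mul0r !subr0 => /(_ isT) H.
rewrite ler_pdivrMr ?exprn_gt0// expr2 mulrA.
have -> : `|x - k%:R / n%:R| * n%:R = `|n%:R * x - k%:~R|.
  rewrite -[X in _ * X](gtr0_norm n0') -normrM mulrBl divfK ?gt_eqF//.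
  by rewrite [x * _]mulrC.
apply: H; apply: (@le_trans _ _ 1); last by rewrite ler1n.
by rewrite invf_le1 ?ltr0n// ler1n.
Qed.

(** * Farey intervals shrinking to an irrational, and the flatness bound *)

(** The inequalities stay strict because an irrational never equals a mediant. *)
Lemma farey_sequence (R : realType) (x : R) : irrational x -> 0 < x < 1 ->
  exists a b c d : nat -> nat,
  [/\ [/\ a 0 = 0, b 0 = 1, c 0 = 1 & d 0 = 1]%N,
      forall j, farey_pair (a j) (b j) (c j) (d j),
      forall j, (a j)%:R / (b j)%:R < x < (c j)%:R / (d j)%:R &
      forall j,
        [/\ a j.+1 = a j, b j.+1 = b j, c j.+1 = a j + c j
          & d j.+1 = b j + d j]%N \/
        [/\ a j.+1 = a j + c j, b j.+1 = b j + d j, c j.+1 = c j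
          & d j.+1 = d j]%N].
Proof.
move=> ix x01.
pose step (v : nat * nat * (nat * nat)) :=
  let: ((a, b), (c, d)) := v in
  if x < (a + c)%:R / (b + d)%:R then ((a, b), (a + c, b + d))%N
  else ((a + c, b + d), (c, d))%N.
pose v j := iter j step ((0, 1), (1, 1))%N.
exists (fun j => (v j).1.1), (fun j => (v j).1.2), (fun j => (v j).2.1),
  (fun j => (v j).2.2).
have vS j : v j.+1 = step (v j) by [].
have fp j : farey_pair (v j).1.1 (v j).1.2 (v j).2.1 (v j).2.2 /\
    (v j).1.1%:R / (v j).1.2%:R < x < (v j).2.1%:R / (v j).2.2%:R.
  elim: j => [|j]; first by rewrite /= mul0r divr1.
  rewrite vS /step; case: (v j) => [[a b] [c d]] /= [abcd /andP[x1 x2]].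
  have [lp rp] := farey_pairS abcd.
  case: ltP => [h|h] /=; first by rewrite x1.
  rewrite x2 andbT lt_neqAle h andbT; split => //.
  apply/eqP => e; apply: ix; exists ((a + c)%:R / (b + d)%:R) => //.
  by rewrite fmorph_div /= !ratr_nat.
split => // j; [by case: (fp j)|by case: (fp j)|].
rewrite vS /step; case: (v j) => [[a b] [c d]] /=.
by case: ifP => _ /=; [left|right].
Qed.

(** The N j are strictly increasing integers, so the tails are dominated by a geometric series. The
    limit is the common point of the nested intervals of radius e j about p j. *)
Lemma geometric_limit (R : realType) (p : nat -> R) (N : nat -> nat) (C g : R) :
  0 <= C -> 0 < g -> (forall j, (N j < N j.+1)%N) ->
  (forall j, `|p j.+1 - p j| <= C * expR (- (g * (N j)%:R))) ->
  exists l : R, forall j,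
    `|p j - l| <= C / (1 - expR (- g)) * expR (- (g * (N j)%:R)).
Proof.
move=> C0 g0 NS pS; set M := C / _; pose e j := M * expR (- (g * (N j)%:R)).
have g1 : 0 < 1 - expR (- g) by rewrite subr_gt0 expR_lt1 oppr_lt0.
have M0 : 0 <= M by rewrite divr_ge0// ltW.
have e0 j : 0 <= e j by rewrite mulr_ge0 ?expR_ge0.
have eS j : `|p j.+1 - p j| <= e j - e j.+1.
  apply: le_trans (pS j) _.
  have -> : C = M * (1 - expR (- g)) by rewrite divfK// gt_eqF.
  rewrite /e -mulrA -mulrBr ler_wpM2l// mulrBl mul1r lerB// -expRD ler_expR.
  by rewrite -opprD lerN2 -[g in g + _]mulr1 -mulrDr ler_pM2l// nat1r ler_nat.
pose lo j := p j - e j; pose hi j := p j + e j.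
have loS : nondecreasing_seq lo.
  apply/nondecreasing_seqP => j; have := eS j.
  by rewrite ler_norml /lo => /andP[]; clear; lra.
have hiS : nonincreasing_seq hi.
  apply/nonincreasing_seqP => j; have := eS j.
  by rewrite ler_norml /hi => /andP[]; clear; lra.
have lohi i : lo i <= hi i by rewrite /lo /hi; have := e0 i; clear; lra.
have ub j : ubound (range lo) (hi j).
  move=> _ [i _ <-]; have [ij|/ltnW ji] := leqP i j.
    exact: le_trans (loS _ _ ij) (lohi j).
  exact: le_trans (lohi i) (hiS _ _ ji).
exists (sup (range lo)) => j; rewrite -/(e j).
have l1 : lo j <= sup (range lo).
  by apply: ub_le_sup; [exists (hi 0%N); exact: ub|exists j].
have l2 : sup (range lo) <= hi j.
  by apply: ge_sup; [exists (lo 0%N); exists 0%N|exact: ub].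
by move: l1 l2; rewrite ler_norml /lo /hi; clear => l1 l2; apply/andP; split; lra.
Qed.

(** A linear factor is absorbed at the price of half the exponent. *)
Lemma mul_expR_le (R : realType) (g x : R) : 0 < g ->
  x * expR (- (2 * g * x)) <= g^-1 * expR (- (g * x)).
Proof.
move=> g0.
have -> : expR (- (2 * g * x)) = expR (- (g * x)) * expR (- (g * x)).
  by rewrite -expRD; congr expR; ring.
rewrite mulrA ler_wpM2r ?expR_ge0// expRN ler_pdivrMr ?expR_gt0//.
rewrite mulrC ler_pdivlMr// mulrC.
by apply: le_trans (expR_ge1Dx _); rewrite lerDr.
Qed.

(** The widths tend to 0, so y leaves the intervals; j precedes the first exit. *)
Lemma farey_exit (R : realType) (a b c d : nat -> nat) (x y : R) :
  (forall j, farey_pair (a j) (b j) (c j) (d j)) ->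
  (forall j, (j < b j + d j)%N) ->
  (forall j, (a j)%:R / (b j)%:R < x < (c j)%:R / (d j)%:R) ->
  (a 0)%:R / (b 0)%:R <= y <= (c 0)%:R / (d 0)%:R -> y != x ->
  exists j, (a j)%:R / (b j)%:R <= y <= (c j)%:R / (d j)%:R /\
    ~~ ((a j.+1)%:R / (b j.+1)%:R <= y <= (c j.+1)%:R / (d j.+1)%:R).
Proof.
move=> fp Nj xI y0 yx.
pose out j := ~~ ((a j)%:R / (b j)%:R <= y <= (c j)%:R / (d j)%:R).
have exo : exists j, out j.
  have yx0 : 0 < `|y - x| by rewrite normr_gt0 subr_eq0.
  pose j := (Num.truncn (2 / `|y - x|)).+1.
  have hj : 2 / `|y - x| < j%:R by rewrite truncnS_gt.
  exists j; apply/negP => /andP[y1 y2].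
  have /andP[x1 x2] := xI j.
  have /andP[_ wd] := farey_pair_width R (fp j).
  have : `|y - x| <= 2 / (b j + d j)%:R.
    apply: le_trans wd; rewrite ler_norml.
    by move: x1 x2 y1 y2; clear => *; apply/andP; split; lra.
  have N0 : 0 < (b j + d j)%:R :> R by rewrite ltr0n (leq_ltn_trans _ (Nj j)).
  rewrite ler_pdivlMr// mulrC -ler_pdivlMr// leNgt => /negP; apply.
  by apply: lt_le_trans hj _; rewrite ler_nat ltnW.
have [m om mmin] := ex_minnP exo.
case: m om mmin => [|m] om mmin; first by rewrite /out y0 in om.
exists m; split => //; apply/negPn/negP => /mmin.
by rewrite ltnn.
Qed.

(** The coefficient bound enters only through k, so A and B are chosen before alpha. *)
Lemma flat_bound (R : realType) (Phi : R -> R) (C h k : R) :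
  {within `[0, 1], continuous Phi} -> 0 <= C -> 0 < h -> 0 < k ->
  almost_additive (homogenize Phi) C h ->
  exists A B : R, [/\ 0 < A, 0 < B & forall alpha : R,
    irrational alpha -> 0 < alpha < 1 ->
    (forall m n : nat, (0 < n)%N -> k / n%:R ^+ 2 <= `|alpha - m%:R / n%:R|) ->
    exists l : R, forall x, 0 <= x + alpha <= 1 ->
      `|Phi (x + alpha) - Phi alpha - l * x| <=
        A * Num.sqrt `|x| * expR (- B / Num.sqrt `|x|)].
Proof.
move=> cPhi C0 h0 k0 aa.
pose g := h / 2; have g0 : 0 < g by rewrite divr_gt0.
have hg : h = 2 * g by rewrite /g mulrC divfK.
pose M := C / g / (1 - expR (- g)).
have g1 : 0 < 1 - expR (- g) by rewrite subr_gt0 expR_lt1 oppr_lt0.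
have M0 : 0 <= M by rewrite !divr_ge0// ltW.
(* At the exit g N >= 2B / sqrt |x|. Half of this exponent is kept, and the other half pays for the
   factor sqrt |x| / B. *)
pose B := g * Num.sqrt k / 2.
have B0 : 0 < B by rewrite divr_gt0// mulr_gt0// sqrtr_gt0.
exists ((2 * C + M + 1) / B), B; split => //.
  by rewrite divr_gt0// ltr_wpDl// addr_ge0// mulr_ge0.
move=> al ial al01 bad.
have [a [b [c [d [[a0 b0 c0 d0] fp alI nxt]]]]] := farey_sequence ial al01.
pose N j := (b j + d j)%N.
have bd j : (0 < b j)%N /\ (0 < d j)%N by have [] := farey_pairP (fp j).
have NS j : (N j < N j.+1)%N.
  rewrite /N; have [b1 d1] := bd j.
  case: (nxt j) => -[_ -> _ ->]; first by rewrite ltn_add2l -[ltnLHS]add0n ltn_add2r.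
  by rewrite ltn_add2r -[ltnLHS]addn0 ltn_add2l.
have Nj j : (j < N j)%N by elim: j => [|j IH]; rewrite ?/N ?b0 ?d0 ?(leq_ltn_trans IH).
pose F := homogenize Phi.
(* Slope and intercept of the chord, by Cramer's rule with determinant 1. *)
pose p j := (b j)%:R * F (c j) (d j) - (d j)%:R * F (a j) (b j).
pose r j := (c j)%:R * F (a j) (b j) - (a j)%:R * F (c j) (d j).
have det j : (b j)%:R * (c j)%:R = (a j)%:R * (d j)%:R + 1 :> R.
  by have /and3P[_ _ /eqP e] := fp j; rewrite -!natrM e -addn1 natrD.
have ea j : F (a j) (b j) = p j * (a j)%:R + r j * (b j)%:R.
  transitivity (((b j)%:R * (c j)%:R - (a j)%:R * (d j)%:R) * F (a j) (b j)).
    by rewrite det addrAC subrr add0r mul1r.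
  by rewrite /p /r; ring.
have ec j : F (c j) (d j) = p j * (c j)%:R + r j * (d j)%:R.
  transitivity (((b j)%:R * (c j)%:R - (a j)%:R * (d j)%:R) * F (c j) (d j)).
    by rewrite det addrAC subrr add0r mul1r.
  by rewrite /p /r; ring.
(* Inserting the mediant changes the slope by b or -d times the additivity error. *)
have pS j : `|p j.+1 - p j| <= C / g * expR (- (g * (N j)%:R)).
  have aj := aa _ _ _ _ (fp j).
  have [b1 d1] := bd j.
  have : `|p j.+1 - p j| <= (N j)%:R * (C * expR (- (h * (N j)%:R))).
    apply: le_trans (ler_pM _ _ (lexx _) aj) => //.
    case: (nxt j) => -[ea' eb' ec' ed'].
      have -> : p j.+1 - p j = (b j)%:R * (F (a j + c j)%N (b j + d j)%N -
          (F (a j) (b j) + F (c j) (d j))).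
        by rewrite /p ea' eb' ec' ed' natrD; ring.
      by rewrite normrM normr_nat ler_wpM2r// ler_nat leq_addr.
    have -> : p j.+1 - p j = - ((d j)%:R * (F (a j + c j)%N (b j + d j)%N -
        (F (a j) (b j) + F (c j) (d j)))).
      by rewrite /p ea' eb' ec' ed' natrD; ring.
    by rewrite normrN normrM normr_nat ler_wpM2r// ler_nat leq_addl.
  move/le_trans; apply; rewrite mulrCA -[leRHS]mulrA ler_wpM2l//.
  by rewrite hg mul_expR_le.
have Cg0 : 0 <= C / g by rewrite divr_ge0// ltW.
have [l hl] := geometric_limit Cg0 g0 NS pS.
exists l => x x01; have [->|x0] := eqVneq x 0.
  (* At x = 0 the factor sqrt |x| makes the right side 0, whatever the quotient in the exponent
     means. *)
  by rewrite add0r subrr mulr0 subrr normr0 sqrtr0 mulr0 mul0r.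
have [||j [yI yO]] := farey_exit fp Nj alI (y := x + al).
- by rewrite a0 b0 c0 d0 mul0r divr1.
- by rewrite -subr_eq0 addrK.
have alIj : (a j)%:R / (b j)%:R <= al <= (c j)%:R / (d j)%:R.
  by have /andP[/ltW -> /ltW ->] := alI j.
have Ey := chord_approx cPhi C0 h0 aa (fp j) (ea j) (ec j) yI.
have Eal := chord_approx cPhi C0 h0 aa (fp j) (ea j) (ec j) alIj.
have lj := hl j; rewrite -/M in lj.
have x1 : `|x| <= 1.
  move: x01 al01; rewrite ler_norml; clear => /andP[? ?] /andP[? ?].
  by apply/andP; split; lra.
have lhs : `|Phi (x + al) - Phi al - l * x| <=
    (2 * C + M + 1) * expR (- (g * (N j)%:R)).
  have -> : Phi (x + al) - Phi al - l * x =
    (Phi (x + al) - (p j * (x + al) + r j)) - (Phi al - (p j * al + r j))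
    + (p j - l) * x by ring.
  apply: le_trans (ler_normD _ _) _.
  have E1 : C * expR (- (h * (N j)%:R)) <= C * expR (- (g * (N j)%:R)).
    by rewrite ler_wpM2l// ler_expR lerN2 ler_wpM2r// /g ler_pdivrMr// ler_peMr// ?ltW// ltr1n.
  have E2 : `|(p j - l) * x| <= M * expR (- (g * (N j)%:R)).
    rewrite normrM; apply: le_trans lj; exact: ler_piMr.
  have E3 := le_trans (ler_normB _ _) (lerD (le_trans Ey E1) (le_trans Eal E1)).
  apply: le_trans (lerD E3 E2) _.
  by have := expR_ge0 (- (g * (N j)%:R)); clear; lra.
apply: le_trans lhs _.
have sx0 : 0 < Num.sqrt `|x| by rewrite sqrtr_gt0 normr_gt0.
(* An end of the next interval, of denominator at most N j, separates x + al from al. *)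
have far : k / (N j)%:R ^+ 2 <= `|x|.
  have sub n : (0 < n)%N -> (n <= N j)%N -> k / (N j)%:R ^+ 2 <= k / n%:R ^+ 2.
    move=> n0 nN; rewrite ler_pM2l// lef_pV2 ?posrE ?exprn_gt0 ?ltr0n//.
      by rewrite ler_pXn2r ?nnegrE// ler_nat.
    exact: leq_trans nN.
  have [bN dN] : (b j.+1 <= N j)%N /\ (d j.+1 <= N j)%N.
    by rewrite /N; case: (nxt j) => -[_ -> _ ->];
      rewrite leqnn ?leq_addr ?leq_addl.
  have [b1 d1] := bd j.+1; have /andP[al1 al2] := alI j.+1.
  move: yO; rewrite negb_and -!ltNge => /orP[y1|y2].
    apply: le_trans (le_trans (sub _ b1 bN) (bad (a j.+1) _ b1)) _.
    have xneg : x <= 0 by move: al1 y1; clear; lra.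
    by rewrite (ler0_norm xneg) gtr0_norm ?subr_gt0//; move: y1; clear; lra.
  apply: le_trans (le_trans (sub _ d1 dN) (bad (c j.+1) _ d1)) _.
  have xpos : 0 <= x by move: al2 y2; clear; lra.
  by rewrite (ger0_norm xpos) distrC gtr0_norm ?subr_gt0//; move: y2; clear; lra.
have N0 : 0 < (N j)%:R :> R by rewrite ltr0n (leq_ltn_trans _ (Nj j)).
have sk : Num.sqrt k <= (N j)%:R * Num.sqrt `|x|.
  rewrite -[X in X * _]gtr0_norm// -sqrtr_sqr -sqrtrM ?sqr_ge0//.
  by apply: ler_wsqrtr; rewrite mulrC -ler_pdivrMr ?exprn_gt0.
have eB : expR (- (g * (N j)%:R)) <= expR (- B / Num.sqrt `|x|) ^+ 2.
  rewrite -expRM_natl ler_expR mulNr mulrN lerN2.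
  have -> : 2 * (B / Num.sqrt `|x|) = g * Num.sqrt k / Num.sqrt `|x|.
    by rewrite /B; field; rewrite gt_eqF.
  by rewrite ler_pdivrMr// -[leRHS]mulrA ler_pM2l.
rewrite -[leRHS]mulrA -[leRHS]mulrA ler_wpM2l//.
  by rewrite addr_ge0// addr_ge0// mulr_ge0.
clearbody B; apply: le_trans eB _; rewrite expr2 [leRHS]mulrA ler_wpM2r ?expR_ge0//.
(* One of the two exponentials is bounded by exp(-u) <= 1/u with u = B / sqrt |x|. *)
have -> : B^-1 * Num.sqrt `|x| = (B / Num.sqrt `|x|)^-1 by rewrite invf_div mulrC.
rewrite mulNr expRN lef_pV2 ?posrE ?expR_gt0 ?divr_gt0//.
by apply: le_trans (expR_ge1Dx _); rewrite lerDr.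
Qed.

(** * From the exponential bound to derivative and infinite flatness *)

(** A single term of the exponential series bounds exp(B/s) below. *)
Lemma expR_inv_flat (R : realType) (B s : R) (n : nat) : 0 < B -> 0 < s ->
  expR (- B / s) <= n.+1`!%:R / B ^+ n.+1 * s ^+ n.+1.
Proof.
move=> B0 s0; have Bs : 0 < B / s by rewrite divr_gt0.
rewrite mulNr expRN.
have -> : n.+1`!%:R / B ^+ n.+1 * s ^+ n.+1 = ((B / s) ^+ n.+1 / n.+1`!%:R)^-1.
  by rewrite invf_div expr_div_n invf_div mulrA mulrAC.
rewrite lef_pV2 ?posrE ?expR_gt0 ?divr_gt0 ?exprn_gt0 ?ltr0n ?fact_gt0//.
by have := expR_ge1Dxn n (ltW Bs); apply: le_trans; rewrite lerDr.
Qed.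

Lemma exp_bound_pow (R : realType) (A B : R) (n : nat) : 0 < A -> 0 < B ->
  exists2 C : R, 0 <= C & forall x : R,
    A * Num.sqrt `|x| * expR (- B / Num.sqrt `|x|) <= C * `|x| ^+ n.+1.
Proof.
(* The factor sqrt |x| and 2n + 1 further ones make |x|^(n + 1). *)
move=> A0 B0; exists (A * ((n.*2).+1`!%:R / B ^+ (n.*2).+1)).
  by rewrite mulr_ge0 ?divr_ge0 ?exprn_ge0 ?ler0n// ltW.
move=> x; have [->|x0] := eqVneq x 0.
  by rewrite normr0 sqrtr0 mulr0 mul0r expr0n mulr0.
have sx0 : 0 < Num.sqrt `|x| by rewrite sqrtr_gt0 normr_gt0.
have -> : `|x| ^+ n.+1 = Num.sqrt `|x| * Num.sqrt `|x| ^+ (n.*2).+1.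
  by rewrite -exprS -doubleS -mul2n exprM sqr_sqrtr.
rewrite -[leLHS]mulrA -[leRHS]mulrA ler_pM2l// [leRHS]mulrCA ler_pM2l//.
exact: expR_inv_flat.
Qed.

(** Identifies the limit of the chord slopes with the derivative of Phi, whose existence is thereby
    proved. *)
Lemma quadratic_derivative (R : realType) (f : R -> R) (a l C dl : R) :
  0 < dl -> 0 <= C ->
  (forall x, `|x| < dl -> `|f (x + a) - f a - l * x| <= C * `|x| ^+ 2) ->
  derivable f a 1 /\ derive1 f a = l.
Proof.
move=> dl0 C0 hf.
have cv : h^-1 *: (f (h + a) - f a) @[h --> 0^'] --> l.
  apply/cvgrPdist_le => e e0; rewrite near_withinE; apply/nbhs_ballP.
  exists (Num.min dl (e / (C + 1))).
    by rewrite /= lt_min dl0 divr_gt0// ltr_wpDl.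
  move=> h; rewrite /ball /= sub0r normrN lt_min => /andP[h1 h2] h0.
  have -> : l - h^-1 *: (f (h + a) - f a) =
            - (h^-1 * (f (h + a) - f a - l * h)).
    by rewrite /GRing.scale /= [in RHS]mulrBr mulrCA mulVf// mulr1 opprB.
  have hn : 0 < `|h| by rewrite normr_gt0.
  rewrite normrN normrM normfV mulrC ler_pdivrMr//.
  apply: le_trans (hf _ h1) _; rewrite expr2 mulrA ler_wpM2r//.
  move: h2; rewrite ltr_pdivlMr ?ltr_wpDl// => /ltW; apply: le_trans.
  by rewrite mulrC ler_wpM2l// lerDl.
have cv' : h^-1 *: ((f \o shift a) (h *: (1 : R)) - f a) @[h --> 0^'] --> l.
  apply: cvg_trans cv; apply: near_eq_cvg; apply: nearW => h /=.
  by rewrite [h *: 1]mulr1.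
by split; [apply/cvg_ex; exists l|exact: (cvg_lim _ cv)].
Qed.

Theorem theorem5p5 (R : realType) (T : markov_tree R) (Phi : R -> R)
    (hT : rising T) (hPhi : encoding_function T Phi) :
  (forall alpha : R, irrational alpha -> 0 < alpha < 1 ->
     (exists K : nat, cf_bounded alpha K) -> infinitely_flat Phi alpha) /\
  (forall K : nat, exists A B : R, 0 < A /\ 0 < B /\
     forall alpha : R, irrational alpha -> 0 < alpha < 1 ->
       cf_bounded alpha K ->
       \forall x \near (0 : R),
         `|Phi (x + alpha) - Phi alpha - derive1 Phi alpha * x|
           <= A * Num.sqrt `|x| * expR (- B / Num.sqrt `|x|)).
Proof.
have [C [h [C0 h0 aa]]] := rising_almost_additive hT hPhi.
have cPhi : {within `[0, 1], continuous Phi} by case: hPhi.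
have main (K : nat) : exists A B : R, [/\ 0 < A, 0 < B & forall alpha : R,
    irrational alpha -> 0 < alpha < 1 -> cf_bounded alpha K ->
    derivable Phi alpha 1 /\ exists2 dl : R, 0 < dl & forall x, `|x| < dl ->
      `|Phi (x + alpha) - Phi alpha - derive1 Phi alpha * x|
        <= A * Num.sqrt `|x| * expR (- B / Num.sqrt `|x|)].
  have k0 : 0 < K.+2%:R^-1 ^+ 2 :> R by rewrite exprn_gt0// invr_gt0 ltr0n.
  have [A [B [A0 B0 hAB]]] := flat_bound cPhi C0 h0 k0 aa.
  exists A, B; split => // al ial al01 hK.
  have [l hl] := hAB al ial al01 (fun m n => cf_bounded_dist m ial hK).
  (* Within this radius x + al stays in [0, 1], where Phi is meaningful. *)
  pose dl := Num.min al (1 - al).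
  have dl0 : 0 < dl by rewrite lt_min subr_gt0.
  have {}hl x : `|x| < dl -> `|Phi (x + al) - Phi al - l * x| <=
      A * Num.sqrt `|x| * expR (- B / Num.sqrt `|x|).
    rewrite lt_min !ltr_norml => /andP[/andP[x1 x2] /andP[x3 x4]].
    by apply: hl; move: x1 x4; clear => x1 x4; apply/andP; split; lra.
  have [D D0 hD] := exp_bound_pow 1 A0 B0.
  have [dPhi ->] := quadratic_derivative dl0 D0
    (fun x xdl => le_trans (hl x xdl) (hD x)).
  by split => //; exists dl.
split => [al ial al01 [K hK]|K]; have [A [B [A0 B0 hAB]]] := main K.
  have [dPhi [dl dl0 hdl]] := hAB al ial al01 hK.
  split => // -[//|n] _; have [D D0 hD] := exp_bound_pow n A0 B0.
  exists dl, D; split => // x; rewrite -ltr_norml => xdl.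
  exact: le_trans (hdl x xdl) (hD x).
exists A, B; do 2 split => //; move=> al ial al01 hK.
have [_ [dl dl0 hdl]] := hAB al ial al01 hK.
apply/nbhs_ballP; exists dl => // x; rewrite /ball /= sub0r normrN.
exact: hdl.
Qed.
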